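(* Let $0<\mu\le 1$, $\sigma>0$, $r_f>0$, $\rho>0$, $\alpha=\sigma^2/2$, $\beta=r_f-\sigma^2/2$, $\gamma=r_f$. The exponential B-spline collocation scheme $$\chi_1\mathscr R_{m-1}^{n+1}+\chi_2\mathscr R_m^{n+1}+\chi_3\mathscr R_{m+1}^{n+1}=\eta\mathscr R_{m-1}^{n}+\mathscr R_m^{n}+\eta\mathscr R_{m+1}^{n}-\sum_{k=1}^{n}w_k\Big[(\eta\mathscr R_{m-1}^{n-k+1}+\mathscr R_m^{n-k+1}+\eta\mathscr R_{m+1}^{n-k+1})-(\eta\mathscr R_{m-1}^{n-k}+\mathscr R_m^{n-k}+\eta\mathscr R_{m+1}^{n-k})\Big]+\widetilde\gamma\,\psi^{n+1}(x_m)$$ for the time-fractional Black-Scholes problem is unconditionally stable in the von Neumann sense. That is, for all mesh sizes $h_x>0$, $h_t>0$ and every wave number $\omega\in\mathbb R$, if complex numbers $\zeta^0,\zeta^1,\zeta^2,\dots$ (the superscript is a time index, not a power) are such that $\delta_m^n=\zeta^n e^{i\omega m h_x}$ (with $i=\sqrt{-1}$) satisfies, for all integers $m$ and all $n\ge 0$, the perturbation equation $$\chi_1\delta_{m-1}^{n+1}+\chi_2\delta_m^{n+1}+\chi_3\delta_{m+1}^{n+1}=\eta\delta_{m-1}^{n}+\delta_m^{n}+\eta\delta_{m+1}^{n}-\sum_{k=1}^{n}w_k\Big[(\eta\delta_{m-1}^{n-k+1}+\delta_m^{n-k+1}+\eta\delta_{m+1}^{n-k+1})-(\eta\delta_{m-1}^{n-k}+\delta_m^{n-k}+\eta\delta_{m+1}^{n-k})\Big],$$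 then $|\zeta^n|\le|\zeta^0|$ for all $n\ge 0$.
   Context: The time-fractional Black-Scholes problem is ${}_0^CD_t^\mu u=\alpha u_{xx}+\beta u_x-\gamma u+\psi$ on $(I_p,F_p)\times(0,\widetilde T)$, with initial condition $u(x,0)=z(x)$ and boundary conditions $u(I_p,t)=\mathscr H(t)$, $u(F_p,t)=\mathscr G(t)$, where ${}_0^CD_t^\mu$ is the Caputo time derivative of order $\mu$. The scheme uses uniform meshes with spacing $h_x$ in space ($x_m=I_p+mh_x$) and $h_t$ in time ($t_n=nh_t$), $\psi^{n}(x)=\psi(x,t_n)$, and the unknowns $\mathscr R_m^n$ are the coefficients of the approximation in the exponential B-spline basis. The perturbation equation is the one satisfied by the difference $\delta_m^n=\mathscr R_m^n-\bar{\mathscr R}_m^n$ of two solutions of the scheme. Notation: $w_k=(k+1)^{1-\mu}-k^{1-\mu}$ for $k\ge1$, $w_0=1$; $\widetilde\gamma=\Gamma(2-\mu)h_t^{\mu}$. With tension parameter $\rho$, $\tilde s=\sinh(\rho h_x)$, $\tilde c=\cosh(\rho h_x)$, $$\eta=\frac{\tilde s-\rho h_x}{2(\rho h_x\tilde c-\tilde s)},\qquad \tilde e=\frac{\rho}{2(\rho h_x\tilde c-\tilde s)},\qquad \bar\eta=\frac{\rho^2\tilde s}{2(\rho h_x\tilde c-\tilde s)},$$ $$\chi_1=\eta-\alpha\widetilde\gamma\bar\eta+\beta\widetilde\gamma\tilde e(\tilde c-1)+\eta\gamma\widetilde\gamma,\qquad \chi_2=1+2\alpha\widetilde\gamma\bar\eta+\gamma\widetilde\gamma,\qquad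 \chi_3=\eta-\alpha\widetilde\gamma\bar\eta-\beta\widetilde\gamma\tilde e(\tilde c-1)+\eta\gamma\widetilde\gamma.$$ Empty sums are zero. *)

(* Defs.v *)
From HB Require Import structures.
From mathcomp Require Import all_boot all_order all_algebra.
From mathcomp Require Import all_classical all_reals all_analysis.
From mathcomp Require Import complex ring.

Set Implicit Arguments.
Unset Strict Implicit.
Unset Printing Implicit Defensive.

Import Order.TTheory GRing.Theory Num.Theory.
Local Open Scope ring_scope.
Local Open Scope complex_scope.

Definition sinh (R : realType) (x : R) : R := (expR x - expR (- x)) / 2.
Definition cosh (R : realType) (x : R) : R := (expR x + expR (- x)) / 2.

(* Euler's integral; it is the Gamma function for 0 < z only. *)
Definition Gamma (R : realType) (z : R) : R :=
  \int[lebesgue_measure]_(t in `]0, +oo[) (t `^ (z - 1) * expR (- t)).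

(* exp(i theta) *)
Definition expi (R : realType) (theta : R) : R[i] := cos theta +i* sin theta.

(* The case k = 0 is separate because the general formula would give
   w 1 0 = 1 - 0^0 = 0. *)
Definition w (R : realType) (mu : R) (k : nat) : R :=
  if k is 0%N then 1 else k.+1%:R `^ (1 - mu) - k%:R `^ (1 - mu).

Definition gammat (R : realType) (mu ht : R) : R := Gamma (2 - mu) * ht `^ mu.

Definition spline_den (R : realType) (rho hx : R) : R :=
  2 * (rho * hx * cosh (rho * hx) - sinh (rho * hx)).

Definition eta (R : realType) (rho hx : R) : R :=
  (sinh (rho * hx) - rho * hx) / spline_den rho hx.

Definition etilde (R : realType) (rho hx : R) : R := rho / spline_den rho hx.

Definition etabar (R : realType) (rho hx : R) : R :=
  rho ^+ 2 * sinh (rho * hx) / spline_den rho hx.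

Definition chi1 (R : realType) (mu alpha beta gamma rho hx ht : R) : R :=
  eta rho hx - alpha * gammat mu ht * etabar rho hx
  + beta * gammat mu ht * etilde rho hx * (cosh (rho * hx) - 1)
  + eta rho hx * gamma * gammat mu ht.

Definition chi2 (R : realType) (mu alpha gamma rho hx ht : R) : R :=
  1 + 2 * alpha * gammat mu ht * etabar rho hx + gamma * gammat mu ht.

Definition chi3 (R : realType) (mu alpha beta gamma rho hx ht : R) : R :=
  eta rho hx - alpha * gammat mu ht * etabar rho hx
  - beta * gammat mu ht * etilde rho hx * (cosh (rho * hx) - 1)
  + eta rho hx * gamma * gammat mu ht.

(* A grid function U has U m n at the node (x_m, t_n). Grid functions are
   complex-valued so that they include the Fourier modes. *)
Definition collocate (R : realType) (rho hx : R) (U : int -> nat -> R[i])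
    (m : int) (n : nat) : R[i] :=
  (eta rho hx)%:C * U (m - 1) n + U m n + (eta rho hx)%:C * U (m + 1) n.

Definition implicit_side (R : realType) (mu alpha beta gamma rho hx ht : R)
    (U : int -> nat -> R[i]) (m : int) (n : nat) : R[i] :=
  (chi1 mu alpha beta gamma rho hx ht)%:C * U (m - 1) n.+1
  + (chi2 mu alpha gamma rho hx ht)%:C * U m n.+1
  + (chi3 mu alpha beta gamma rho hx ht)%:C * U (m + 1) n.+1.

Definition history_side (R : realType) (mu rho hx : R)
    (U : int -> nat -> R[i]) (m : int) (n : nat) : R[i] :=
  collocate rho hx U m n
  - \sum_(1 <= k < n.+1) (w mu k)%:C *
      (collocate rho hx U m (n - k + 1) - collocate rho hx U m (n - k)).

Definition scheme_eq (R : realType) (mu alpha beta gamma rho hx ht Ip : R)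
    (psi : R -> R -> R) (U : int -> nat -> R[i]) (m : int) (n : nat) : Prop :=
  implicit_side mu alpha beta gamma rho hx ht U m n =
  history_side mu rho hx U m n
  + (gammat mu ht * psi (Ip + m%:~R * hx) (n.+1%:R * ht))%:C.

Definition perturbation_eq (R : realType) (mu alpha beta gamma rho hx ht : R)
    (delta : int -> nat -> R[i]) (m : int) (n : nat) : Prop :=
  implicit_side mu alpha beta gamma rho hx ht delta m n =
  history_side mu rho hx delta m n.

Lemma scheme_eq_sub (R : realType) (mu alpha beta gamma rho hx ht Ip : R)
    (psi : R -> R -> R) (U V : int -> nat -> R[i]) (m : int) (n : nat) :
  scheme_eq mu alpha beta gamma rho hx ht Ip psi U m n ->
  scheme_eq mu alpha beta gamma rho hx ht Ip psi V m n ->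
  perturbation_eq mu alpha beta gamma rho hx ht
    (fun j l => U j l - V j l) m n.
Proof.
have colB l : collocate rho hx (fun j l => U j l - V j l) m l =
    collocate rho hx U m l - collocate rho hx V m l.
  by rewrite /collocate; ring.
move=> hU hV; rewrite /perturbation_eq.
have -> : implicit_side mu alpha beta gamma rho hx ht
    (fun j l => U j l - V j l) m n =
    implicit_side mu alpha beta gamma rho hx ht U m n
    - implicit_side mu alpha beta gamma rho hx ht V m n.
  by rewrite /implicit_side; ring.
rewrite hU hV /history_side colB.
have -> (a b c d e : R[i]) : a - b + e - (c - d + e) = a - c - (b - d) by ring.
rewrite -sumrB; congr (_ - _).
by apply: eq_bigr => k _; rewrite !colB; ring.
Qed.

(* Main.v *)
Require Import Defs.
From mathcomp Require Import all_boot all_order all_algebra.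
From mathcomp Require Import all_classical all_reals all_analysis.
From mathcomp Require Import complex.
From mathcomp Require Import ring lra.

Import Order.TTheory GRing.Theory Num.Theory.
Local Open Scope ring_scope.
Local Open Scope complex_scope.

(** On a Fourier mode both sides of the perturbation equation are
multiplication operators. Write theta = omega * hx. Collocation multiplies the
amplitude by the real number S = 1 + 2 * eta * cos theta, and the implicit side
multiplies it by a complex number X with
  Re X = (1 + gamma * g) * S + 2 * alpha * g * etabar * (1 - cos theta),
where g is [gammat mu ht]; the drift beta enters only the imaginary part. The
equation at m = 0 thus reads
  X * zeta (n + 1) = S * H n,
where H n is zeta n minus the weighted sum of the earlier increments of zeta.

Two facts give the bound. First, |2 * eta| < 1 ([norm_2eta_lt1]), which comes
down to sinh y < y * cosh y for 0 < y; therefore S > 0, and since g, etabar,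
alpha and gamma are nonnegative, |X| >= Re X >= S
([spline_symbol_le_implicit]). Hence |zeta (n + 1)| <= |H n|, whatever the mesh
sizes are. Secondly, the weights w_k are nonnegative and nonincreasing with
w_0 = 1, by concavity of t |-> t ^ (1 - mu) ([w_decr]); summation by parts then
turns H n into a convex combination of zeta 0, ..., zeta n
([memory_norm_le]), and strong induction on n concludes. *)

(** * Hyperbolic inequalities and the spline coefficients *)

Lemma sinh_gt0 {R : realType} (x : R) : 0 < x -> 0 < sinh x.
Proof.
move=> x0; rewrite divr_gt0 // subr_gt0 ltr_expR; lra.
Qed.

Lemma cosh_gt1 {R : realType} (x : R) : 0 < x -> 1 < cosh x.
Proof.
move=> x0; have /expR_gt1Dx h1 : x != 0 by rewrite gt_eqF.
have /expR_gt1Dx h2 : - x != 0 by rewrite oppr_eq0 gt_eqF.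
rewrite /cosh; lra.
Qed.

Lemma sinh0 {R : realType} : sinh 0 = 0 :> R.
Proof. by rewrite /sinh oppr0 subrr mul0r. Qed.

Lemma is_derive_sinh {R : realType} (x : R) : is_derive x 1 (@sinh R) (cosh x).
Proof.
rewrite /sinh /cosh.
have -> : (fun x : R => (expR x - expR (- x)) / 2) =
  2^-1 *: (expR - (expR \o -%R)).
  by apply/funext => y; exact: mulrC.
apply: is_derive_eq; rewrite /GRing.scale /=; ring.
Qed.

Lemma is_derive_cosh {R : realType} (x : R) : is_derive x 1 (@cosh R) (sinh x).
Proof.
rewrite /sinh /cosh.
have -> : (fun x : R => (expR x + expR (- x)) / 2) =
  2^-1 *: (expR + (expR \o -%R)).
  by apply/funext => y; exact: mulrC.
apply: is_derive_eq; rewrite /GRing.scale /=; ring.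
Qed.

(** The difference x * cosh x - sinh x vanishes at 0 and has the derivative
x * sinh x, which is positive for 0 < x. *)
Lemma sinh_lt_mul_cosh {R : realType} (x : R) : 0 < x -> sinh x < x * cosh x.
Proof.
move=> x0; pose f : R -> R := (id * @cosh R) - @sinh R.
have df (y : R) : is_derive y 1 f (y * sinh y).
  have dc := is_derive_cosh y; have ds := is_derive_sinh y.
  apply: is_derive_eq; rewrite /GRing.scale /=; ring.
have [|c cx] := MVT x0 (fun y _ => df y).
  by apply: derivable_within_continuous => y _; have [] := df y.
rewrite /f !fctE mul0r sinh0 !subr0 => e.
rewrite -subr_gt0 e mulr_gt0 //.
move: cx; rewrite in_itv /= => /andP[c0 _].
by rewrite mulr_gt0 // sinh_gt0.
Qed.

Lemma spline_den_gt0 {R : realType} (rho hx : R) :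
  0 < rho -> 0 < hx -> 0 < spline_den rho hx.
Proof.
move=> r0 h0; rewrite mulr_gt0 // subr_gt0; exact/sinh_lt_mul_cosh/mulr_gt0.
Qed.

Lemma sinh_half_angle {R : realType} (x : R) :
  sinh x = 2 * sinh (x / 2) * cosh (x / 2).
Proof.
rewrite /sinh /cosh.
have -> : expR x = expR (x / 2) ^+ 2 by rewrite expr2 -expRD; congr expR; field.
have -> : expR (- x) = expR (- (x / 2)) ^+ 2.
  by rewrite expr2 -expRD; congr expR; field.
by field.
Qed.

Lemma coshD1_half_angle {R : realType} (x : R) : cosh x + 1 = 2 * cosh (x / 2) ^+ 2.
Proof.
rewrite /cosh.
have -> : expR x = expR (x / 2) ^+ 2 by rewrite expr2 -expRD; congr expR; field.
have -> : expR (- x) = expR (- (x / 2)) ^+ 2.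
  by rewrite expr2 -expRD; congr expR; field.
have : expR (x / 2) * expR (- (x / 2)) = 1 by rewrite expRN divff // gt_eqF ?expR_gt0.
by move=> e; field : e.
Qed.

(** With x = rho * hx, the lower bound -1 < 2 * eta says x < x * cosh x. The upper
bound says 2 * sinh x < x * (cosh x + 1); in terms of y = x / 2 this is
sinh y < y * cosh y multiplied by 4 * cosh y. *)
Lemma norm_2eta_lt1 {R : realType} (rho hx : R) :
  0 < rho -> 0 < hx -> `|2 * eta rho hx| < 1.
Proof.
move=> r0 h0; have D0 := spline_den_gt0 _ _ r0 h0.
have x0 := mulr_gt0 r0 h0.
rewrite /eta mulrA normrM normfV (gtr0_norm D0) ltr_pdivrMr // mul1r.
rewrite /spline_den; set x := rho * hx in x0 *.
have y0 : 0 < x / 2 by rewrite divr_gt0.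
have c1 := cosh_gt1 _ x0; have k1 := cosh_gt1 _ y0.
have s0 := sinh_gt0 _ x0.
have hy := sinh_lt_mul_cosh _ y0.
have := sinh_half_angle x; have := coshD1_half_angle x => ec es.
have h1 : x < x * cosh x by rewrite ltr_pMr.
have h2 : 2 * sinh x < x * (cosh x + 1).
  rewrite ec es.
  have := ltr_pM2r (lt_trans ltr01 k1) (sinh (x/2)) (x/2 * cosh (x/2)).
  rewrite hy; nra.
rewrite ltr_norml; apply/andP; split; lra.
Qed.

(** * The symbol of the scheme *)

(** The Gamma factor integrates a nonnegative function, and a divergent integral
has the real value 0. *)
Lemma gammat_ge0 {R : realType} (mu ht : R) : 0 <= gammat mu ht.
Proof.
rewrite mulr_ge0 ?powR_ge0 //; apply: Rintegral_ge0 => t _.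
by rewrite mulr_ge0 ?powR_ge0 ?expR_ge0.
Qed.

Lemma etabar_ge0 {R : realType} (rho hx : R) :
  0 < rho -> 0 < hx -> 0 <= etabar rho hx.
Proof.
move=> r0 h0; apply: divr_ge0; last exact/ltW/spline_den_gt0.
by apply: mulr_ge0; [exact: sqr_ge0 | exact/ltW/sinh_gt0/mulr_gt0].
Qed.

Definition spline_symbol {R : realType} (rho hx theta : R) : R :=
  1 + 2 * eta rho hx * cos theta.

Lemma spline_symbol_gt0 {R : realType} (rho hx theta : R) :
  0 < rho -> 0 < hx -> 0 < spline_symbol rho hx theta.
Proof.
move=> r0 h0; rewrite /spline_symbol.
have lt1 : `|2 * eta rho hx * cos theta| < 1.
  rewrite normrM; apply: le_lt_trans (norm_2eta_lt1 rho hx r0 h0).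
  by rewrite ler_piMr // ler_norml cos_geN1 cos_le1.
by move: lt1; rewrite ltr_norml => /andP[]; lra.
Qed.

Lemma collocate_mode {R : realType} (rho hx omega : R) (z : nat -> R[i]) n :
  collocate rho hx (fun j l => z l * expi (omega * j%:~R * hx)) 0 n
  = (spline_symbol rho hx (omega * hx))%:C * z n.
Proof.
rewrite /collocate /spline_symbol /expi sub0r add0r mulr0z mulr0 mul0r.
rewrite mulrN1z mulr1z mulrN mulr1 mulNr cosN sinN cos0 sin0.
case: (z n) => a b; apply/eqP; rewrite eq_complex /=.
by apply/andP; split; apply/eqP; ring.
Qed.

(** The coefficients chi1 e^(-i theta) + chi2 + chi3 e^(i theta), grouped so that
the real part shows the spline symbol. *)
Definition implicit_symbol {R : realType}
    (mu alpha beta gamma rho hx ht theta : R) : R[i] :=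
  let g := gammat mu ht in
  ((1 + gamma * g) * spline_symbol rho hx theta
    + 2 * alpha * g * etabar rho hx * (1 - cos theta))
  -i* (2 * beta * g * etilde rho hx * (cosh (rho * hx) - 1) * sin theta).

Lemma implicit_mode {R : realType} (mu alpha beta gamma rho hx ht omega : R)
    (z : nat -> R[i]) n :
  implicit_side mu alpha beta gamma rho hx ht
    (fun j l => z l * expi (omega * j%:~R * hx)) 0 n
  = implicit_symbol mu alpha beta gamma rho hx ht (omega * hx) * z n.+1.
Proof.
rewrite /implicit_side /implicit_symbol /spline_symbol /chi1 /chi2 /chi3 /expi.
rewrite sub0r add0r mulr0z mulr0 mul0r.
rewrite mulrN1z mulr1z mulrN mulr1 mulNr cosN sinN cos0 sin0.
case: (z n.+1) => a b; apply/eqP; rewrite eq_complex /=.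
by apply/andP; split; apply/eqP; ring.
Qed.

(** The diffusion and reaction terms only increase the real part, and the
convection term, being imaginary, cannot decrease the modulus. This is where
the absence of any restriction on the mesh comes from. *)
Lemma spline_symbol_le_implicit {R : realType}
    (mu alpha beta gamma rho hx ht theta : R) :
  0 <= alpha -> 0 <= gamma -> 0 < rho -> 0 < hx ->
  (spline_symbol rho hx theta)%:C
    <= `|implicit_symbol mu alpha beta gamma rho hx ht theta|.
Proof.
move=> a0 c0 r0 h0; apply: le_trans (normc_ge_Re _); rewrite lecR /=.
have S0 := spline_symbol_gt0 rho hx theta r0 h0.
have g0 := gammat_ge0 mu ht; have b0 := etabar_ge0 rho hx r0 h0.
apply: le_trans (ler_norm _); rewrite mulrDl mul1r -addrA lerDl.
have S1 := ltW S0; have cos1 : 0 <= 1 - cos theta by rewrite subr_ge0 cos_le1.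
apply: addr_ge0; first exact: mulr_ge0 (mulr_ge0 c0 g0) S1.
have a2 : 0 <= 2 * alpha by rewrite mulr_ge0.
exact: mulr_ge0 (mulr_ge0 (mulr_ge0 a2 g0) b0) cos1.
Qed.

(** * The L1 weights *)

(** Bernoulli's inequality: ln is concave, so ln (a * x + (1 - a) * 1) is at least
a * ln x. *)
Lemma powR_le_tangent {R : realType} (a x : R) :
  0 <= a <= 1 -> 0 < x -> x `^ a <= 1 + a * (x - 1).
Proof.
move=> a01 x0; have /andP[a0 a1] := a01.
have := @concave_ln R (Itv01 a0 a1) x 1 x0 ltr01.
rewrite !convRE /= ln1 mulr0 addr0 mulr1 => h.
have t0 : 0 < 1 + a * (x - 1).
  have [-> |ax] := eqVneq a 0; first by rewrite mul0r addr0.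
  have ax0 : 0 < a * x by rewrite mulr_gt0 // lt0r ax.
  lra.
rewrite -ler_ln ?posrE ?powR_gt0 // ln_powR.
apply: le_trans h _; rewrite le_eqVlt; apply/orP; left; apply/eqP; congr ln.
by rewrite /unstable.onem; ring.
Qed.

(** Both powers lie below the tangent of t |-> t ^ a at the midpoint c, and the
linear terms of the two tangent bounds cancel. *)
Lemma powR_midpoint_concave {R : realType} (a x y : R) :
  0 <= a <= 1 -> 0 < x -> 0 < y -> x `^ a + y `^ a <= 2 * ((x + y) / 2) `^ a.
Proof.
move=> a01 x0 y0; set c := (x + y) / 2.
have c0 : 0 < c by rewrite divr_gt0 // addr_gt0.
have tangent_bound (t : R) : 0 < t -> t `^ a <= (1 + a * (t / c - 1)) * c `^ a.
  move=> t0; have tc0 : 0 < t / c by rewrite divr_gt0.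
  rewrite -{1}(mulfVK (lt0r_neq0 c0) t) powRM ?(ltW tc0) ?(ltW c0) //.
  by rewrite ler_wpM2r ?powR_ge0 // powR_le_tangent.
apply: le_trans (lerD (tangent_bound x x0) (tangent_bound y y0)) _.
rewrite le_eqVlt; apply/orP; left; apply/eqP.
rewrite -mulrDl; congr (_ * _); rewrite /c; field.
by rewrite gt_eqF // addr_gt0.
Qed.

Lemma w_ge0 {R : realType} (mu : R) k : mu <= 1 -> 0 <= w mu k.
Proof.
move=> mu1; case: k => [|k] //=; rewrite subr_ge0.
by apply: ge0_ler_powR; rewrite ?subr_ge0 ?nnegrE ?ler_nat.
Qed.

(** For positive k this is midpoint concavity at k, k + 1, k + 2. The first step
is separate because w_0 is 1 by convention, also when mu = 1; it says
2 ^ (1 - mu) - 1 <= 1. *)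
Lemma w_decr {R : realType} (mu : R) k : 0 <= mu <= 1 -> w mu k.+1 <= w mu k.
Proof.
move=> /andP[mu0 mu1]; case: k => [|k] /=.
  have : (2 : R) `^ (1 - mu) <= 2 by rewrite ler1_powR ?ler1n //; lra.
  by rewrite powR1; lra.
have h : 0 <= 1 - mu <= 1 by apply/andP; split; lra.
have := powR_midpoint_concave (1 - mu) k.+1%:R k.+3%:R h (ltr0Sn _ _) (ltr0Sn _ _).
have -> : (k.+1%:R + k.+3%:R) / 2 = k.+2%:R :> R by rewrite -!natr1; field.
lra.
Qed.

(** * The discrete memory *)

(** In the use below u k is the amplitude k steps in the past. *)
Lemma memory_by_parts {K : comPzRingType} (b u : nat -> K) n :
  b 0%N * u 0%N - \sum_(k < n) b k.+1 * (u k - u k.+1)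
  = \sum_(k < n) (b k - b k.+1) * u k + b n * u n.
Proof.
elim: n => [|n IHn]; first by rewrite !big_ord0; ring.
rewrite !big_ord_recr /= opprD addrA IHn; ring.
Qed.

(** Summation by parts gives past amplitudes the coefficients b k - b (k + 1) and
the initial one b n. These are nonnegative and add up to b 0 = 1, so the
expression is a convex combination of values in the ball of radius M. *)
Lemma memory_norm_le {K : numDomainType} (b z : nat -> K) n (M : K) :
  b 0%N = 1 -> (forall k, b k.+1 <= b k) -> (forall k, 0 <= b k) ->
  (forall k, (k <= n)%N -> `|z k| <= M) ->
  `|z n - \sum_(1 <= k < n.+1) b k * (z (n - k + 1)%N - z (n - k)%N)| <= M.
Proof.
move=> b0 bd bp zM.
have -> : z n - \sum_(1 <= k < n.+1) b k * (z (n - k + 1)%N - z (n - k)%N)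
    = \sum_(k < n) (b k - b k.+1) * z (n - k)%N + b n * z (n - n)%N.
  rewrite -(memory_by_parts b (fun k => z (n - k)%N)) b0 mul1r subn0.
  rewrite big_add1 big_mkord; congr (_ - _); apply: eq_bigr => k _.
  by rewrite addn1 subnSK.
have -> : M = \sum_(k < n) (b k - b k.+1) * M + b n * M.
  rewrite -mulr_suml -mulrDl -(big_mkord xpredT (fun k => b k - b k.+1)).
  rewrite (telescope_sumr_eq (fun k => - b k)) //=; last by move=> k _; ring.
  by rewrite b0; ring.
apply: le_trans (ler_normD _ _) _; apply: lerD.
  apply: le_trans (ler_norm_sum _ _ _) _; apply: ler_sum => k _.
  have bk : 0 <= b k - b k.+1 by rewrite subr_ge0.
  by rewrite normrM ger0_norm // ler_wpM2l // zM // leq_subr.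
by rewrite normrM ger0_norm // ler_wpM2l // zM // leq_subr.
Qed.

Theorem theorem4p1 (R : realType) (mu sigma rf rho alpha beta gamma : R)
    (hmu0 : 0 < mu) (hmu1 : mu <= 1) (hsigma : 0 < sigma) (hrf : 0 < rf)
    (hrho : 0 < rho) (halpha : alpha = sigma ^+ 2 / 2)
    (hbeta : beta = rf - sigma ^+ 2 / 2) (hgamma : gamma = rf)
    (hx ht : R) (hhx : 0 < hx) (hht : 0 < ht) (omega : R)
    (zeta : nat -> R[i])
    (hzeta : forall (m : int) (n : nat),
      perturbation_eq mu alpha beta gamma rho hx ht
        (fun j l => zeta l * expi (omega * j%:~R * hx)) m n) :
  forall n : nat, `|zeta n| <= `|zeta 0%N|.
Proof.
have alpha0 : 0 <= alpha by rewrite halpha divr_ge0 ?sqr_ge0.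
have gamma0 : 0 <= gamma by rewrite hgamma ltW.
elim/ltn_ind => -[//|n] IHn.
set S := spline_symbol rho hx (omega * hx).
set X := implicit_symbol mu alpha beta gamma rho hx ht (omega * hx).
set H := zeta n - \sum_(1 <= k < n.+1) (w mu k)%:C *
  (zeta (n - k + 1)%N - zeta (n - k)%N).
have SC0 : 0 < S%:C by rewrite ltcR; exact: spline_symbol_gt0.
(* At the node m = 0 the factor of the mode is 1. *)
have step : X * zeta n.+1 = S%:C * H.
  rewrite -implicit_mode (hzeta 0 n) /history_side collocate_mode mulrBr.
  congr (_ - _); rewrite mulr_sumr; apply: eq_bigr => k _.
  by rewrite !collocate_mode -/S; ring.
have HM : `|H| <= `|zeta 0%N|.
  apply: (memory_norm_le (fun k => (w mu k)%:C)) => [//|k|k|k kn].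
  - by rewrite lecR w_decr // (ltW hmu0).
  - by rewrite lecR w_ge0.
  - exact: IHn.
apply: le_trans HM; rewrite -(ler_pM2l SC0).
rewrite -{2}(gtr0_norm SC0) -normrM -step normrM ler_wpM2r //.
exact: spline_symbol_le_implicit.
Qed.
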